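(* Let $\mathbf M=(M,+,\cdot,\vec 0)$ be a module over a unitary commutative ring $(S,+,\cdot,0,1)$ with a fixed basis $(\vec b_i)_{i\in I}$. Then the mappings $U\mapsto P_U$ and $P\mapsto P(M)$ are mutually inverse isomorphisms between $\mathbf L_s(\mathbf M)=(L_s(\mathbf M),\subseteq,{}^\perp,\{\vec 0\},M)$ and $\mathbf{Pr}(\mathbf M)=(\mathrm{Pr}(\mathbf M),\leq,{}',\mathbf 0,\mathbf I)$ (isomorphisms of bounded posets with a unary operation).
   Context: Basis: a family $(\vec b_i)_{i\in I}$ of elements of $M$, $I$ a non-empty set, such that for every $\vec x\in M$ there is exactly one function $f:I\to S$ with $f(i)=0$ for all but finitely many $i$ and $\sum_{i\in I}f(i)\vec b_i=\vec x$; the coordinates of $\vec x$ are $x_i:=f(i)$. The inner product is $\vec x\vec y:=\sum_{i\in I}x_iy_i\in S$. Write $\vec x\perp\vec y$ if $\vec x\vec y=0$, and for $C\subseteq M$ put $C^\perp:=\{\vec x\in M\mid\vec x\perp\vec y\text{ for all }\vec y\in C\}$. A submodule $U$ of $\mathbf M$ is called splitting if $U+U^\perp=M$ and $U\cap U^\perp=\{\vec 0\}$, where $U+W:=\{\vec x+\vec y\mid \vec x\in U,\vec y\in W\}$. $L_s(\mathbf M)$ is the set of all splitting submodules. For $U\in L_s(\mathbf M)$, $P_U$ denotes the unique mapping from $M$ to $M$ with $P_U(\vec x)\in U$ and $\vec x-P_U(\vec x)\in U^\perp$ for all $\vec x\in M$. A projection of $\mathbf M$ is a linear mapping $P:M\to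 M$ with $P\circ P=P$ and $(P\vec x)\vec y=\vec x(P\vec y)$ for all $\vec x,\vec y\in M$. $\mathrm{Pr}(\mathbf M)$ is the set of all projections, with $P\leq Q$ defined as $P(M)\subseteq Q(M)$. $\mathbf 0$ is the constant mapping with value $\vec 0$, $\mathbf I$ the identity mapping on $M$, and $P':=\mathbf I-P$. *)

(* Defs.v *)
From mathcomp Require Import all_boot all_order all_algebra.
From mathcomp Require Import finmap all_classical.
Set Implicit Arguments.
Unset Strict Implicit.
Unset Printing Implicit Defensive.
Import GRing.Theory.
Local Open Scope classical_set_scope.
Local Open Scope ring_scope.

Section Basis.
Variables (S : comPzRingType) (M : lmodType S) (I : choiceType) (b : I -> M).

(* The \sum_(i \in A) of fsbigop is a genuine finite sum only when the summand
   has finite support; the first conjunct guarantees it. *)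
Definition represents (x : M) (f : I -> S) : Prop :=
  finite_set [set i | f i <> 0] /\ \sum_(i \in [set: I]) f i *: b i = x.

Definition is_basis : Prop := forall x : M, exists! f : I -> S, represents x f.

(* When b is a basis, the function chosen by xget is the unique one
   representing x; the default value is then irrelevant. *)
Definition coord (x : M) : I -> S := xget (fun=> 0) [set f | represents x f].

Definition inner (x y : M) : S :=
  \sum_(i \in [set: I]) coord x i * coord y i.

Definition perp (C : set M) : set M :=
  [set x | forall y, C y -> inner x y = 0].

Definition add_set (U W : set M) : set M := [set x + y | x in U & y in W].

Definition splitting (U : set M) : Prop :=
  [/\ submod_closed (mem U),
      add_set U (perp U) = setT &
      U `&` perp U = [set 0]].

Definition proj_onto (U : set M) (P : M -> M) : Prop :=
  forall x, U (P x) /\ perp U (x - P x).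

(* See proj_of_unique: for splitting U this is the only P with proj_onto U P. *)
Definition proj_of (U : set M) : M -> M := xget (idfun : M -> M) [set P | proj_onto U P].

Definition is_projection (P : M -> M) : Prop :=
  [/\ linear P,
      P \o P = P &
      forall x y, inner (P x) y = inner x (P y)].

End Basis.

Record bposet_op (T : Type) := BPosetOp {
  carrier : set T;
  ple : T -> T -> Prop;
  pop : T -> T;
  pbot : T;
  ptop : T }.

Definition is_bposet_op (T : Type) (A : bposet_op T) : Prop :=
  [/\ [/\ carrier A (pbot A), carrier A (ptop A) &
          forall x, carrier A x -> carrier A (pop A x)],
      forall x, carrier A x -> ple A x x,
      forall x y, carrier A x -> carrier A y ->
        ple A x y -> ple A y x -> x = y,
      forall x y z, carrier A x -> carrier A y -> carrier A z ->
        ple A x y -> ple A y z -> ple A x z &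
      forall x, carrier A x -> ple A (pbot A) x /\ ple A x (ptop A)].

Definition bposet_op_iso (T T' : Type) (A : bposet_op T) (B : bposet_op T')
    (f : T -> T') : Prop :=
  [/\ set_bij (carrier A) (carrier B) f,
      forall x y, carrier A x -> carrier A y ->
        (ple A x y <-> ple B (f x) (f y)),
      forall x, carrier A x -> f (pop A x) = pop B (f x),
      f (pbot A) = pbot B &
      f (ptop A) = ptop B].

Section Posets.
Variables (S : comPzRingType) (M : lmodType S) (I : choiceType) (b : I -> M).

Definition Ls : bposet_op (set M) :=
  {| carrier := [set U | splitting b U];
     ple := subset;
     pop := perp b;
     pbot := [set 0];
     ptop := setT |}.

Definition Pr : bposet_op (M -> M) :=
  {| carrier := [set P | is_projection b P];
     ple := fun P Q => range P `<=` range Q;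
     pop := fun P x => x - P x;
     pbot := fun=> 0;
     ptop := idfun |}.

End Posets.

Section ProjOf.
Variables (S : comPzRingType) (M : lmodType S) (I : choiceType) (b : I -> M).
Hypothesis bP : is_basis b.

Lemma coordP (x : M) : represents b x (coord b x).
Proof. by have [f [fx _]] := bP x; exact: (@xgetI _ _ _ f). Qed.

Lemma coord_unique (x : M) (f : I -> S) : represents b x f -> f = coord b x.
Proof.
have [g [_ gu]] := bP x.
by move=> /gu <-; rewrite (gu _ (coordP x)).
Qed.

Lemma coordB (x y : M) (i : I) : coord b (x - y) i = coord b x i - coord b y i.
Proof.
have [/finite_fsetP[A sA] sx] := coordP x.
have [/finite_fsetP[B sB] sy] := coordP y.
have x0 j : j \notin (A `|` B)%fset -> coord b x j = 0.
  rewrite inE negb_or => /andP[/negP jA _]; apply: contrapT => xj.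
  by apply: jA; have : [set` A] j by rewrite -sA.
have y0 j : j \notin (A `|` B)%fset -> coord b y j = 0.
  rewrite inE negb_or => /andP[_ /negP jB]; apply: contrapT => yj.
  by apply: jB; have : [set` B] j by rewrite -sB.
suff /coord_unique <- :
  represents b (x - y) (fun i => coord b x i - coord b y i) by [].
split.
  apply: (@sub_finite_set _ _ [set` (A `|` B)%fset]); last exact: finite_fset.
  move=> j /= xy0; apply: contrapT => /negP jAB.
  by apply: xy0; rewrite x0// y0// subrr.
rewrite -[in RHS]sx -[in RHS]sy !(@fsbigTE _ _ _ _ (A `|` B)%fset).
- by rewrite -sumrB; apply: eq_bigr => j _; rewrite scalerBl.
- by move=> j /y0 ->; rewrite scale0r.
- by move=> j /x0 ->; rewrite scale0r.
- by move=> j jAB; rewrite x0// y0// subrr scale0r.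
Qed.

Lemma innerBl (x y z : M) : inner b (x - y) z = inner b x z - inner b y z.
Proof.
have [/finite_fsetP[A sA] _] := coordP z.
have z0 j : j \notin A -> coord b z j = 0.
  move=> /negP jA; apply: contrapT => zj.
  by apply: jA; have : [set` A] j by rewrite -sA.
rewrite /inner !(@fsbigTE _ _ _ _ A) -?sumrB.
- by apply: eq_bigr => j _; rewrite coordB mulrBl.
- by move=> j /z0 ->; rewrite mulr0.
- by move=> j /z0 ->; rewrite mulr0.
- by move=> j /z0 ->; rewrite mulr0.
Qed.

Lemma proj_of_unique (U : set M) : splitting b U ->
  proj_onto b U (proj_of b U) /\
  (forall P, proj_onto b U P -> P = proj_of b U).
Proof.
move=> [Usub UT U0].
have UB u v : U u -> U v -> U (u - v).
  have [_ subU] := GRing.submod_closedB Usub.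
  by move=> /mem_set Uu /mem_set Uv; have /set_mem := subU _ _ Uu Uv.
have ex x : exists y, U y /\ perp b U (x - y).
  have : add_set U (perp b U) x by rewrite UT.
  by move=> [y Uy [z Uz <-]]; exists y; rewrite addrC addKr.
have projU : proj_onto b U (proj_of b U).
  by have [P PU] := choice ex; apply: (@xgetI _ _ _ P).
split=> // P PU; apply/funext => x.
have [UP1 oP1] := PU x; have [UP2 oP2] := projU x.
suff : (U `&` perp b U) (P x - proj_of b U x).
  by rewrite U0 => /subr0_eq.
split; first exact: UB.
have -> : P x - proj_of b U x = (x - proj_of b U x) - (x - P x).
  by rewrite opprB [RHS]addrC addrA subrK.
by move=> y Uy; rewrite innerBl oP1// oP2// subr0.
Qed.

End ProjOf.

(* Main.v *)
(* Pairing with b_i reads off the i-th coordinate, so a vector orthogonal to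
   all of M vanishes. The inner product need not be definite, so x perp x does
   not give x = 0; but x orthogonal to both U and U^perp does, as soon as
   U + U^perp = M. This yields U^perp^perp = U for splitting U, hence
   P_(U^perp) = I - P_U, and also that the range of a projection splits. *)
Require Import Defs.
From mathcomp Require Import all_boot all_order all_algebra.
From mathcomp Require Import finmap all_classical.
Set Implicit Arguments.
Unset Strict Implicit.
Unset Printing Implicit Defensive.
Import GRing.Theory.
Local Open Scope classical_set_scope.
Local Open Scope ring_scope.

(** * Coordinates, bilinearity and nondegeneracy of the inner product *)

Section Inner.
Context {S : comPzRingType} {M : lmodType S} {I : choiceType} {b : I -> M}.
Hypothesis bP : is_basis b.

Lemma coordZ (a : S) (x : M) (i : I) : Defs.coord b (a *: x) i = a * Defs.coord b x i.
Proof.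
have [/finite_fsetP[A sA] sx] := coordP bP x.
have x0 j : j \notin A -> Defs.coord b x j = 0.
  move=> /negP jA; apply: contrapT => xj.
  by apply: jA; have : [set` A] j by rewrite -sA.
suff /(coord_unique bP) <- : represents b (a *: x) (fun i => a * Defs.coord b x i) by [].
split.
  (* Only an inclusion of supports: [a] may annihilate some of the coordinates. *)
  apply: (@sub_finite_set _ _ [set` A]); last exact: finite_fset.
  by move=> j /= ax0; apply: contrapT => /negP jA; apply: ax0; rewrite x0// mulr0.
rewrite -[in RHS]sx !(@fsbigTE _ _ _ _ A).
- by rewrite scaler_sumr; apply: eq_bigr => j _; rewrite scalerA.
- by move=> j /x0 ->; rewrite scale0r.
- by move=> j /x0 ->; rewrite mulr0 scale0r.
Qed.

Lemma coord_basis (i j : I) : Defs.coord b (b i) j = (j == i)%:R.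
Proof.
suff /(coord_unique bP) <- : represents b (b i) (fun j => (j == i)%:R) by [].
have i0 k : k \notin [fset i]%fset -> (k == i)%:R = 0 :> S.
  by rewrite inE => /negPf ->.
split.
  (* Inclusion rather than equality: over the zero ring the support is empty. *)
  apply: (@sub_finite_set _ _ [set` [fset i]%fset]); last exact: finite_fset.
  by move=> k /= ki; apply: contrapT => /negP /i0.
rewrite (@fsbigTE _ _ _ _ [fset i]%fset); last by move=> k /i0 ->; rewrite scale0r.
by rewrite big_seq_fset1 eqxx scale1r.
Qed.

Lemma innerC (x y : M) : inner b x y = inner b y x.
Proof. by apply: eq_fsbigr => i _; rewrite mulrC. Qed.

Lemma innerZl (a : S) (x y : M) : inner b (a *: x) y = a * inner b x y.
Proof.
have [/finite_fsetP[A sA] _] := coordP bP y.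
have y0 j : j \notin A -> Defs.coord b y j = 0.
  move=> /negP jA; apply: contrapT => yj.
  by apply: jA; have : [set` A] j by rewrite -sA.
rewrite /inner !(@fsbigTE _ _ _ _ A).
- by rewrite mulr_sumr; apply: eq_bigr => j _; rewrite coordZ mulrA.
- by move=> j /y0 ->; rewrite mulr0.
- by move=> j /y0 ->; rewrite mulr0.
Qed.

Lemma inner0l (y : M) : inner b 0 y = 0.
Proof. by rewrite -(subrr y) innerBl// subrr. Qed.

(** Reduces to [innerBl] by writing [x] as [(x + y) - y]. *)
Lemma innerDl (x y z : M) : inner b (x + y) z = inner b x z + inner b y z.
Proof. by rewrite -{2}(addrK y x) innerBl// subrK. Qed.

Lemma innerDr (x y z : M) : inner b x (y + z) = inner b x y + inner b x z.
Proof. by rewrite ![inner b x _]innerC innerDl. Qed.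

Lemma inner_basis (x : M) (i : I) : inner b x (b i) = Defs.coord b x i.
Proof.
rewrite /inner (@fsbigTE _ _ _ _ [fset i]%fset).
  by rewrite big_seq_fset1 coord_basis eqxx mulr1.
by move=> k; rewrite inE coord_basis => /negPf ->; rewrite mulr0.
Qed.

Lemma inner_nondegenerate (x : M) : (forall y, inner b x y = 0) -> x = 0.
Proof.
move=> x0; have [_ <-] := coordP bP x.
by apply: fsbig1 => i _; rewrite -inner_basis x0 scale0r.
Qed.

(** * Orthogonal complements and splitting submodules *)

Lemma perp_setT : perp b setT = [set 0].
Proof.
apply/seteqP; split => x /=; first by move=> x0; apply: inner_nondegenerate => y; exact: x0.
by move=> -> y _; exact: inner0l.
Qed.

(** Bridge from [Prop]-valued membership to the boolean predicate that [submod_closed] expects;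
    [splitting_linear] goes the other way. *)
Lemma submod_closed_mem (U : set M) : U 0 ->
  (forall a x y, U x -> U y -> U (a *: x + y)) -> submod_closed (mem U).
Proof.
move=> U0 UL; split; first exact: mem_set.
by move=> a x y /set_mem Ux /set_mem Uy; apply: mem_set; exact: UL.
Qed.

Lemma splitting_linear (U : set M) : splitting b U ->
  U 0 /\ forall a x y, U x -> U y -> U (a *: x + y).
Proof.
move=> [[U0 UL] _ _]; split; first exact: set_mem U0.
by move=> a x y /mem_set Ux /mem_set Uy; have /set_mem := UL a x y Ux Uy.
Qed.

Lemma perp_linear (C : set M) (a : S) (x y : M) :
  perp b C x -> perp b C y -> perp b C (a *: x + y).
Proof. by move=> Cx Cy z Cz; rewrite innerDl innerZl Cx// Cy// mulr0 addr0. Qed.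

Lemma sub_perp_perp (U : set M) : U `<=` perp b (perp b U).
Proof. by move=> x Ux y Uy; rewrite innerC; exact: Uy. Qed.

Lemma perp_cap_perp (U : set M) : add_set U (perp b U) = setT ->
  perp b U `&` perp b (perp b U) = [set 0].
Proof.
move=> UT; apply/seteqP; split => [x [Ux UUx] | x ->]; last first.
  by split=> y _; exact: inner0l.
apply: inner_nondegenerate => y.
have : add_set U (perp b U) y by rewrite UT.
by move=> [u Uu [v Uv <-]]; rewrite innerDr Ux// UUx// addr0.
Qed.

Lemma perp_perp (U : set M) : splitting b U -> perp b (perp b U) = U.
Proof.
move=> sU; have [_ UT _] := sU; have [_ UL] := splitting_linear sU.
apply/seteqP; split; last exact: sub_perp_perp.
move=> x UUx; have : add_set U (perp b U) x by rewrite UT.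
move=> [u Uu [v Uv uvx]].
(* The component [v = x - u] lies in U^perp by choice, and in U^perp^perp because both [x] and [u]
   do. *)
suff /= v0 : [set 0] v by rewrite -uvx v0 addr0.
rewrite -(perp_cap_perp UT); split=> //.
have -> : v = -1 *: u + x by rewrite -uvx scaleN1r addKr.
by apply: perp_linear => //; exact: sub_perp_perp.
Qed.

Lemma splitting_perp (U : set M) : splitting b U -> splitting b (perp b U).
Proof.
move=> sU; have [_ UT _] := sU; split.
- by apply: submod_closed_mem; [move=> y _; exact: inner0l | exact: perp_linear].
(* Since U^perp^perp = U, this is the decomposition for [U] with its summands swapped. *)
- rewrite perp_perp//; apply/seteqP; split => // x _.
  have : add_set U (perp b U) x by rewrite UT.
  by move=> [u Uu [v Uv <-]]; exists v => //; exists u => //; rewrite addrC.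
- exact: perp_cap_perp.
Qed.

Lemma splitting_setT : splitting b setT.
Proof.
split; first exact: submod_closed_mem.
- apply/seteqP; split => // x _; exists x => //; exists 0; last exact: addr0.
  by move=> y _; exact: inner0l.
- by rewrite setTI perp_setT.
Qed.

Lemma splitting_set0 : splitting b [set 0].
Proof. by rewrite -perp_setT; apply: splitting_perp; exact: splitting_setT. Qed.

(** * From a projection to its range *)

Section Projection.
Context {P : M -> M}.
Hypothesis pP : is_projection b P.

Lemma projection_idem (x : M) : P (P x) = P x.
Proof. by have [_ PP _] := pP; rewrite -[RHS](congr1 (@^~ x) PP). Qed.

Lemma projection0 : P 0 = 0.
(* With scalar -1 and both vectors zero, linearity reads [P 0 = - P 0 + P 0]. *)
Proof. by have [PL _ _] := pP; have := PL (-1) 0 0; rewrite scaler0 addr0 scaleN1r addNr. Qed.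

(** Self-adjointness moves [P] to the left factor; by idempotence both terms of
    [inner b (x - P x) (P y)] then equal [inner b (P x) y]. *)
Lemma proj_onto_range : proj_onto b (range P) P.
Proof.
have [_ _ Psym] := pP.
move=> x; split; first by exists x.
by move=> _ [y _ <-]; rewrite innerBl// -2!Psym projection_idem subrr.
Qed.

Lemma splitting_range : splitting b (range P).
Proof.
have [PL _ Psym] := pP; split.
- apply: submod_closed_mem; first by exists 0 => //; exact: projection0.
  by move=> a _ _ [x _ <-] [y _ <-]; exists (a *: x + y) => //; exact: PL.
- apply/seteqP; split => // x _; have [Px Qx] := proj_onto_range x.
  by exists (P x) => //; exists (x - P x) => //; rewrite addrC subrK.
- apply/seteqP; split => [_ [[x _ <-] Px]|_ ->]; last first.
    split; first by exists 0 => //; exact: projection0.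
    by move=> y _; exact: inner0l.
  (* Pairing [P x] with [z] equals pairing [P x] with [P z], which vanishes as [P x] is orthogonal
     to the range. *)
  apply: inner_nondegenerate => z.
  by rewrite -projection_idem Psym; apply: Px; exists z.
Qed.

Lemma proj_of_range : proj_of b (range P) = P.
Proof.
have [_ PU] := proj_of_unique bP splitting_range.
by rewrite -(PU _ proj_onto_range).
Qed.

End Projection.

(** * From a splitting submodule to its projection *)

Section ProjOf.
Context {U : set M}.
Hypothesis sU : splitting b U.

Let onU : proj_onto b U (proj_of b U).
Proof. by have [] := proj_of_unique bP sU. Qed.

(** Pointwise form of [proj_of_unique]: two candidate values differ by an element of both U and
    U^perp. It serves to compute single values of [proj_of b U]. *)
Lemma proj_of_eq (x u : M) : U u -> perp b U (x - u) -> proj_of b U x = u.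
Proof.
move=> Uu xu; have [_ UL] := splitting_linear sU; have [_ _ U0] := sU.
have [Px Qx] := onU x.
suff : (U `&` perp b U) (-1 *: u + proj_of b U x).
  by rewrite U0 /= scaleN1r addrC => /subr0_eq.
split; first exact: UL.
have -> : -1 *: u + proj_of b U x = -1 *: (x - proj_of b U x) + (x - u).
  by rewrite !scaleN1r opprB addrA subrK addrC.
exact: perp_linear.
Qed.

Lemma range_proj_of : range (proj_of b U) = U.
Proof.
apply/seteqP; split => [_ [x _ <-]|x Ux]; first by have [] := onU x.
by exists x => //; apply: proj_of_eq => //; rewrite subrr => y _; exact: inner0l.
Qed.

Lemma is_projection_proj_of : is_projection b (proj_of b U).
Proof.
have [_ UL] := splitting_linear sU.
(* Dropping the U^perp part of [y] leaves an expression symmetric in [x] and [y], whence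
   self-adjointness. *)
have sym1 x y : inner b (proj_of b U x) y = inner b (proj_of b U x) (proj_of b U y).
  have [Px _] := onU x; have [_ Qy] := onU y.
  by rewrite -{1}(subrK (proj_of b U y) y) innerDr [X in X + _]innerC Qy// add0r.
split.
- move=> a x y; have [Px Qx] := onU x; have [Py Qy] := onU y.
  (* The remainder is [a *: (x - P x) + (y - P y)] with [P] standing for [proj_of b U], hence in
     U^perp. *)
  apply: proj_of_eq; first exact: UL.
  by rewrite opprD addrACA -scalerBr; exact: perp_linear.
- apply/funext => x; have [Px _] := onU x.
  by apply: proj_of_eq => //; rewrite subrr => y _; exact: inner0l.
- by move=> x y; rewrite sym1 [RHS]innerC [RHS]sym1 innerC.
Qed.

Lemma proj_of_perp : proj_of b (perp b U) = (fun x => x - proj_of b U x).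
Proof.
have [_ PU] := proj_of_unique bP (splitting_perp sU).
rewrite -(PU (fun x => x - proj_of b U x))// => x; have [Px Qx] := onU x.
by split=> //; rewrite opprB addrC subrK; exact: sub_perp_perp.
Qed.

End ProjOf.

(** * Bounds and complements of projections *)

Lemma range_idfun : range (@idfun M) = setT.
Proof. by apply/seteqP; split => // x _; exists x. Qed.

Lemma range_zero : range (fun _ : M => 0 : M) = [set 0 : M].
Proof. by apply/seteqP; split => [_ [x _ <-] //|_ ->]; exists 0. Qed.

Lemma is_projection_idfun : is_projection b idfun.
Proof. by split. Qed.

Lemma is_projection0 : is_projection b (fun _ : M => 0).
Proof.
split=> //.
- by move=> a x y; rewrite scaler0 addr0.
- by move=> x y; rewrite inner0l innerC inner0l.
Qed.

(** [P] is the projection onto its range U, so I - P is the projection onto U^perp and has U^perp as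
    range. *)
Lemma range_compl (P : M -> M) : is_projection b P ->
  range (fun x => x - P x) = perp b (range P).
Proof.
move=> pP; have sP := splitting_range pP.
by rewrite -{1}(proj_of_range pP) -proj_of_perp// range_proj_of//; exact: splitting_perp.
Qed.

Lemma is_projection_compl (P : M -> M) : is_projection b P ->
  is_projection b (fun x => x - P x).
Proof.
move=> pP; have sP := splitting_range pP.
rewrite -{1}(proj_of_range pP) -proj_of_perp//.
by apply: is_projection_proj_of; exact: splitting_perp.
Qed.

(** * The two bounded posets and the isomorphisms between them *)

Lemma Ls_bposet_op : is_bposet_op (Ls b).
Proof.
split=> /=.
- by split; [exact: splitting_set0 | exact: splitting_setT | exact: splitting_perp].
- by move=> U _.
- by move=> U V _ _ UV VU; apply/seteqP.
- by move=> U V W _ _ _; exact: subset_trans.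
- by move=> U /splitting_linear[U0 _]; split=> // _ ->.
Qed.

Lemma Pr_bposet_op : is_bposet_op (Pr b).
Proof.
split=> /=.
- by split; [exact: is_projection0 | exact: is_projection_idfun | exact: is_projection_compl].
- by move=> P _.
(* Antisymmetry: a projection is recovered from its range. *)
- move=> P Q pP pQ PQ QP; rewrite -(proj_of_range pP) -(proj_of_range pQ).
  by congr (proj_of b _); apply/seteqP.
- by move=> P Q R _ _ _; exact: subset_trans.
- move=> P pP; rewrite range_idfun range_zero; split=> // _ ->.
  by exists 0 => //; exact: projection0.
Qed.

Lemma proj_of_iso : bposet_op_iso (Ls b) (Pr b) (proj_of b).
Proof.
split=> /=.
- split=> [U sU|U V /set_mem sU /set_mem sV UV|P pP].
  + exact: is_projection_proj_of.
  + by rewrite -(range_proj_of sU) -(range_proj_of sV) UV.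
  + by exists (range P); [exact: splitting_range | exact: proj_of_range].
- by move=> U V sU sV; rewrite !range_proj_of.
- by move=> U sU; exact: proj_of_perp.
(* Each bound of [Ls] is the range of a known projection, which [proj_of] therefore returns. *)
- by rewrite -range_zero proj_of_range//; exact: is_projection0.
- by rewrite -range_idfun proj_of_range//; exact: is_projection_idfun.
Qed.

Lemma range_iso : bposet_op_iso (Pr b) (Ls b) (fun P => range P).
Proof.
split=> /=.
- split=> [P pP|P Q /set_mem pP /set_mem pQ PQ|U sU].
  + exact: splitting_range.
  + by rewrite -(proj_of_range pP) -(proj_of_range pQ) PQ.
  + by exists (proj_of b U); [exact: is_projection_proj_of | exact: range_proj_of].
(* The order on projections is by definition inclusion of ranges. *)
- by [].
- by move=> P pP; exact: range_compl.
- exact: range_zero.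
- exact: range_idfun.
Qed.

End Inner.

Theorem theorem5p5 (S : comPzRingType) (M : lmodType S) (I : choiceType)
    (b : I -> M) (I_nonempty : inhabited I) (b_basis : is_basis b) :
  [/\ is_bposet_op (Ls b) /\ is_bposet_op (Pr b),
      bposet_op_iso (Ls b) (Pr b) (fun U => proj_of b U),
      bposet_op_iso (Pr b) (Ls b) (fun P => range P),
      (forall U, splitting b U -> range (proj_of b U) = U) &
      (forall P, is_projection b P -> proj_of b (range P) = P)].
Proof.
split.
- by split; [exact: Ls_bposet_op | exact: Pr_bposet_op].
- exact: proj_of_iso.
- exact: range_iso.
- by move=> U; exact: range_proj_of.
- by move=> P; exact: proj_of_range.
Qed.
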